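(* Assume the following hypothesis: if $\gamma$ is a local minimizer of $\mathcal{F}$ in $\mathcal{A}_{\mathrm{pin}}$, then $\gamma\in C^2([0,L];\mathbf{R}^2)$ and its signed curvature $k$ satisfies $k(0)=k(L)=0$. Let $\gamma\in\mathcal{A}_{\mathrm{pin}}$ be a $1$-fold well-periodic curve. Then $\gamma$ is not a local minimizer of $\mathcal{F}$ in $\mathcal{A}_{\mathrm{pin}}$.
   Context: Let $p\in(1,\infty)$, $L>0$, and $P_0,P_1\in\mathbf{R}^2$ with $|P_0-P_1|<L$. Let $W^{2,p}_{\mathrm{arc}}(0,L;\mathbf{R}^2):=\{\gamma\in W^{2,p}(0,L;\mathbf{R}^2) : |\gamma'|\equiv 1\}$ and $$\mathcal{A}_{\mathrm{pin}}:=\{\gamma\in W^{2,p}_{\mathrm{arc}}(0,L;\mathbf{R}^2) : \gamma(0)=P_0,\ \gamma(L)=P_1\},$$ equipped with the relative topology induced by the $W^{2,p}$-norm. The signed curvature $k$ of an arclength parametrized planar curve $\gamma$ is defined by $\gamma''=kN$, where $N$ is $\gamma'$ rotated counterclockwise by $\pi/2$. Let $f:[0,\infty)\to[0,\infty]$ be a Borel function and $\mathcal{F}(\gamma):=\int_0^L f(|k|)\,ds$. A local minimizer of $\mathcal{F}$ in $X$ is an $x\in X$ with $\mathcal{F}(x)\le\mathcal{F}(x')$ for all $x'$ in some neighborhood of $x$ in $X$. An arclength parametrized planar curve $\gamma:[0,L]\to\mathbf{R}^2$ is well-periodic if it has continuous signed curvature $k\in C([0,L])$ of the form $k(s)=\Phi(s-s_0)$,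 where $s_0\in\mathbf{R}$ and $\Phi\in C(\mathbf{R})$ is an odd function that is antiperiodic with antiperiod $T>0$ (i.e. $\Phi(x+T)=-\Phi(x)$ for all $x$) such that $\{s\in\mathbf{R}:\Phi(s)=0\}=T\mathbf{Z}$; $T$ is called the antiperiod of $\gamma$. For a positive integer $m$, a well-periodic curve $\gamma:[0,L]\to\mathbf{R}^2$ is $\frac m2$-fold if $k(0)=0$ and $T=L/m$. (So $1$-fold means $m=2$.) *)

(* Defs.v *)
From HB Require Import structures.
From mathcomp Require Import all_boot all_order all_algebra.
From mathcomp Require Import all_classical all_reals all_analysis.
From mathcomp Require Import measurable_realfun.

Set Implicit Arguments.
Unset Strict Implicit.
Unset Printing Implicit Defensive.

Import Order.TTheory GRing.Theory Num.Theory.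
Import numFieldNormedType.Exports.

Local Open Scope classical_set_scope.
Local Open Scope ring_scope.

(* Functions and curves on [0, L] are total functions on R of which only the
   values on [0, L] matter: every notion below is insensitive to the values
   taken outside [0, L]. *)

Definition dom {R : realType} (L : R) : set R := [set` `[0, L] ].

(* The product type R * R carries the sup norm, so that the Euclidean norm has
   to be defined. *)
Definition enorm {R : realType} (v : R * R) : R :=
  Num.sqrt (v.1 ^+ 2 + v.2 ^+ 2).

Definition dotp {R : realType} (v w : R * R) : R := v.1 * w.1 + v.2 * w.2.

(* Counterclockwise rotation by pi / 2. *)
Definition rot90 {R : realType} (v : R * R) : R * R := (- v.2, v.1).

Definition in_Lp {R : realType} (p L : R) (u : R -> R) : Prop :=
  u \_ (dom L) \in Lfun (@lebesgue_measure R) p%:E.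

Definition Lp_norm {R : realType} (p L : R) (u : R -> R) : \bar R :=
  Lnorm (@lebesgue_measure R) p%:E (EFin \o (u \_ (dom L))).

(* C^1_c(0, L), extended by zero. *)
Definition test_function {R : realType} (L : R) (phi : R -> R) : Prop :=
  [/\ forall x, derivable phi x 1, continuous (derive1 phi) &
      exists a b : R, [/\ 0 < a, b < L &
        forall x, x \notin `[a, b] -> phi x = 0]].

Definition weak_derivative {R : realType} (L : R) (u g : R -> R) : Prop :=
  [/\ (@lebesgue_measure R).-integrable (dom L) (EFin \o u),
      (@lebesgue_measure R).-integrable (dom L) (EFin \o g) &
      forall phi, test_function L phi ->
        \int[@lebesgue_measure R]_(x in dom L) (u x * derive1 phi x) =
        - \int[@lebesgue_measure R]_(x in dom L) (g x * phi x)].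

(* A representative of the weak derivative, which is unique up to equality
   almost everywhere (junk value 0 if there is no weak derivative). *)
Definition wderiv {R : realType} (L : R) (u : R -> R) : R -> R :=
  xget (fun=> 0) [set g | weak_derivative L u g].

(* W^{1,p}(0, L) and W^{2,p}(0, L), defined as in Brezis, Functional Analysis,
   Sobolev Spaces and PDE, Sections 8.2-8.3, with C^1_c test functions. *)
Definition W1p {R : realType} (p L : R) (u : R -> R) : Prop :=
  in_Lp p L u /\ exists2 g, in_Lp p L g & weak_derivative L u g.

Definition W2p {R : realType} (p L : R) (u : R -> R) : Prop :=
  W1p p L u /\ W1p p L (wderiv L u).

Definition wderivc {R : realType} (L : R) (gamma : R -> R * R) : R -> R * R :=
  fun s => (wderiv L (fst \o gamma) s, wderiv L (snd \o gamma) s).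

Definition W2p_norm {R : realType} (p L : R) (gamma : R -> R * R) : \bar R :=
  (Lp_norm p L (enorm \o gamma)
   + Lp_norm p L (enorm \o wderivc L gamma)
   + Lp_norm p L (enorm \o wderivc L (wderivc L gamma)))%E.

(* An element of W^{2,p}(0, L; R^2) is represented by its continuous
   representative. Its derivative also has a continuous representative, for
   which |gamma'| = 1 almost everywhere means |gamma'| = 1 everywhere. *)
Definition W2p_arc {R : realType} (p L : R) : set (R -> R * R) :=
  [set gamma | [/\ {within dom L, continuous gamma},
     W2p p L (fst \o gamma), W2p p L (snd \o gamma) &
     {ae @lebesgue_measure R, forall s, dom L s ->
        enorm (wderivc L gamma s) = 1}]].

Definition A_pin {R : realType} (p L : R) (P0 P1 : R * R) :
    set (R -> R * R) :=
  [set gamma | [/\ W2p_arc p L gamma, gamma 0 = P0 & gamma L = P1]].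

(* The signed curvature k of gamma in W^{2,p}_arc, defined almost everywhere by
   gamma'' = k N, i.e. k = <gamma'', N> since |N| = 1 and gamma'' is orthogonal
   to gamma'. *)
Definition wcurvature {R : realType} (L : R) (gamma : R -> R * R) (s : R) : R :=
  dotp (wderivc L (wderivc L gamma) s) (rot90 (wderivc L gamma s)).

Definition energy {R : realType} (f : R -> \bar R) (L : R)
    (gamma : R -> R * R) : \bar R :=
  (\int[@lebesgue_measure R]_(s in dom L) f (`|wcurvature L gamma s|%R))%E.

(* The neighborhoods are those of the topology induced on X by the
   W^{2,p}-norm. *)
Definition local_minimizer {R : realType} (p L : R) (X : set (R -> R * R))
    (F : (R -> R * R) -> \bar R) (gamma : R -> R * R) : Prop :=
  X gamma /\ exists2 r : R, 0 < r &
    forall eta, X eta ->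
      (W2p_norm p L (fun s => (eta s - gamma s)%R) < r%:E)%E ->
      (F gamma <= F eta)%E.

(* u is in C^1([0, L]) with derivative g, one-sided at the endpoints: u' exists
   in (0, L) and g extends it continuously to [0, L]. *)
Definition C1_deriv {R : realType} {V : normedModType R} (L : R)
    (u g : R -> V) : Prop :=
  [/\ {within dom L, continuous u}, {within dom L, continuous g} &
      forall s, s \in `]0, L[ -> is_derive s 1 u (g s)].

Definition C2 {R : realType} (L : R) (gamma : R -> R * R) : Prop :=
  exists gamma1 gamma2 : R -> R * R, C1_deriv L gamma gamma1 /\ C1_deriv L gamma1 gamma2.

(* gamma is an arclength parametrized C^2 curve with signed curvature k. *)
Definition signed_curvature {R : realType} (L : R) (gamma : R -> R * R)
    (k : R -> R) : Prop :=
  exists gamma1 gamma2 : R -> R * R, [/\ C1_deriv L gamma gamma1,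
    C1_deriv L gamma1 gamma2,
    forall s, dom L s -> enorm (gamma1 s) = 1 &
    forall s, dom L s -> gamma2 s = k s *: rot90 (gamma1 s)].

(* gamma is well-periodic with signed curvature k and antiperiod T. *)
Definition well_periodic {R : realType} (L : R) (gamma : R -> R * R)
    (k : R -> R) (T : R) : Prop :=
  [/\ signed_curvature L gamma k, {within dom L, continuous k}, 0 < T &
    exists (s0 : R) (Phi : R -> R),
      [/\ continuous Phi,
          forall x, Phi (- x) = - Phi x,
          forall x, Phi (x + T) = - Phi x,
          forall x, Phi x = 0 <-> exists n : int, x = n%:~R * T &
          forall s, dom L s -> k s = Phi (s - s0)]].

(* m / 2-fold well-periodic curves; 1-fold means m = 2. *)
Definition half_fold {R : realType} (m : nat) (L : R)
    (gamma : R -> R * R) : Prop :=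
  (0 < m)%N /\ exists (k : R -> R) (T : R),
    [/\ well_periodic L gamma k T, k 0 = 0 & T = L / m%:R].

(* Main.v *)
Require Import Defs.
From HB Require Import structures.
From mathcomp Require Import all_boot all_order all_algebra.
From mathcomp Require Import all_classical all_reals all_analysis.
From mathcomp Require Import measurable_realfun.
From mathcomp Require Import ring lra.
Import Order.TTheory GRing.Theory Num.Theory.
Import numFieldNormedType.Exports.
Local Open Scope classical_set_scope.
Local Open Scope ring_scope.

Set Implicit Arguments.
Unset Strict Implicit.
Unset Printing Implicit Defensive.

(** The unit tangent of a 1-fold well-periodic curve closes up: its curvature is
odd and L-periodic, so the turning angle is L-periodic. Hence the curve extends
to all of R with an L-periodic tangent, and sliding the window [0, L] along the
extension by a small e gives a competitor with the same endpoints and the same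
energy, close to the original curve in W^{2,p}. If the original curve were a
local minimizer, so would be the slid one, whose curvature at 0 is k(e) <> 0:
this contradicts the boundary condition k(0) = 0 of local minimizers.

As [wderiv] is only a chosen representative, weak derivatives are computed by
their a.e. uniqueness, proved by testing against C^1 functions increasing to
indicators of intervals. *)

(** * Calculus on the line and on [0, L] *)

(** The curve itself satisfies k(0) = 0, so the boundary condition alone does not exclude it; it
    only excludes a slid copy. Minimality passes to the copy because the two energies are equal and
    a small ball around the copy lies in the minimizing ball of the original. Here k(0) = 0 also
    serves a second purpose: it forces s0 into TZ, so that the curvature is odd about 0 itself,
    while L = 2T makes L a period of it.

    Since f is merely Borel and the energy may be infinite, the energies are compared by translation
    invariance of nonnegative integrals, without any subtraction. Since [wderiv] is a choice, it is
    additive only almost everywhere and the triangle inequality for [W2p_norm] is not immediate. For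
    an arbitrary competitor x, the norms of x minus the two curves are therefore compared directly:
    the derivatives of x cancel almost everywhere, and only pointwise bounds between two smooth
    curves remain. *)

Lemma is_derive_cvg {R : realType} {V : normedModType R} (u : R -> V) (s : R) d :
  is_derive s 1 u d <-> h^-1 *: (u (h + s) - u s) @[h --> 0^'] --> d.
Proof.
have E : (fun h => h^-1 *: ((u \o shift s) (h *: (1 : R)) - u s)) =
         (fun h : R => h^-1 *: (u (h + s) - u s)).
  by apply/funext => h /=; rewrite [h *: _]mulr1.
split.
  by case=> + <-; rewrite /derivable /derive E.
move=> cu; split.
  by rewrite /derivable E; apply/cvg_ex; exists d.
by rewrite /derive E; exact/cvg_lim.
Qed.

Lemma is_derive_fst {R : realType} (u : R -> R * R) (s : R) d :
  is_derive s 1 u d -> is_derive s 1 (fst \o u) d.1.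
Proof.
move=> /is_derive_cvg cu; apply/is_derive_cvg.
exact: (@cvg_comp _ _ _ _ fst _ _ _ cu (@cvg_fst _ _ _ _ _)).
Qed.

Lemma is_derive_snd {R : realType} (u : R -> R * R) (s : R) d :
  is_derive s 1 u d -> is_derive s 1 (snd \o u) d.2.
Proof.
move=> /is_derive_cvg cu; apply/is_derive_cvg.
exact: (@cvg_comp _ _ _ _ snd _ _ _ cu (@cvg_snd _ _ _ _ _)).
Qed.

Lemma within_continuous_fst {R : realType} (A : set R) (u : R -> R * R) :
  {within A, continuous u} -> {within A, continuous (fst \o u)}.
Proof.
move=> /subspace_continuousP cu; apply/subspace_continuousP => x Ax.
exact: (@cvg_comp _ _ _ _ fst _ _ _ (cu x Ax) (@cvg_fst _ _ _ _ _)).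
Qed.

Lemma within_continuous_snd {R : realType} (A : set R) (u : R -> R * R) :
  {within A, continuous u} -> {within A, continuous (snd \o u)}.
Proof.
move=> /subspace_continuousP cu; apply/subspace_continuousP => x Ax.
exact: (@cvg_comp _ _ _ _ snd _ _ _ (cu x Ax) (@cvg_snd _ _ _ _ _)).
Qed.

Lemma C1_deriv_fst {R : realType} (L : R) (u g : R -> R * R) :
  C1_deriv L u g -> C1_deriv L (fst \o u) (fst \o g).
Proof.
move=> [cu cg dug]; split; [exact: within_continuous_fst..|].
by move=> s sL; apply: is_derive_fst; exact: dug.
Qed.

Lemma C1_deriv_snd {R : realType} (L : R) (u g : R -> R * R) :
  C1_deriv L u g -> C1_deriv L (snd \o u) (snd \o g).
Proof.
move=> [cu cg dug]; split; [exact: within_continuous_snd..|].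
by move=> s sL; apply: is_derive_snd; exact: dug.
Qed.

Lemma is_derive_continuous {R : realType} (u g : R -> R) :
  (forall s : R, is_derive s 1 u (g s)) -> continuous u.
Proof.
move=> du s; apply/differentiable_continuous/derivable1_diffP.
by case: (du s).
Qed.

Lemma is_derive_C1_deriv {R : realType} (L : R) (u g : R -> R) :
  (forall s : R, is_derive s 1 u (g s)) -> continuous g -> C1_deriv L u g.
Proof.
move=> du cg; split; [|exact: continuous_subspaceT|by []].
by apply: continuous_subspaceT; exact: is_derive_continuous du.
Qed.

Lemma within_eq_segment {R : realType} (L : R) (u v : R -> R) : 0 < L ->
  {within dom L, continuous u} -> {within dom L, continuous v} ->
  {in `]0, L[, u =1 v} -> {in `[0, L], u =1 v}.
Proof.
move=> L0 /(continuous_within_itvP _ L0)[_ u0 uL]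
  /(continuous_within_itvP _ L0)[_ v0 vL] uv s.
rewrite in_itv/= le_eqVlt => /andP[/predU1P[<- _|s0]].
  apply: (cvg_unique (@Rhausdorff R) u0).
  apply: cvg_trans v0; apply: near_eq_cvg; near=> t.
  apply/esym/uv; rewrite in_itv/=; apply/andP; split; first by near: t; exact: nbhs_right_gt.
  by near: t; exact: nbhs_right_lt.
rewrite le_eqVlt => /predU1P[->|sL]; last by apply: uv; rewrite in_itv/= s0.
apply: (cvg_unique (@Rhausdorff R) uL).
apply: cvg_trans vL; apply: near_eq_cvg; near=> t.
apply/esym/uv; rewrite in_itv/=; apply/andP; split; last by near: t; exact: nbhs_left_lt.
by near: t; exact: nbhs_left_gt.
Unshelve. all: by end_near. Qed.

(** In the interior, differentiability is local and derivatives are unique; continuity of both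
    candidates carries the equality to the endpoints, where [C1_deriv] asserts no derivative. The
    endpoint matters: the final contradiction is read off at s = 0. *)
Lemma C1_deriv_unique {R : realType} (L : R) (u v g h : R -> R) : 0 < L ->
  C1_deriv L u g -> C1_deriv L v h -> {in `]0, L[, u =1 v} ->
  {in `[0, L], g =1 h}.
Proof.
move=> L0 [_ cg du] [_ ch dv] uv; apply: within_eq_segment => // s sL.
have duv : is_derive s 1 v (g s).
  apply: near_eq_is_derive (du s sL); near=> t; apply: uv.
  by near: t; exact: near_in_itvoo.
by have := dv s sL => -[_ <-]; case: duv => _ <-.
Unshelve. all: by end_near. Qed.

Lemma C1_deriv0_cst {R : realType} (L : R) (u : R -> R) :
  {within dom L, continuous u} ->
  (forall s : R, s \in `]0, L[ -> is_derive s 1 u 0) ->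
  forall s t, s \in `[0, L] -> t \in `[0, L] -> u s = u t.
Proof.
move=> cu du s t; wlog st : s t / s <= t => [H|].
  by case: (leP s t) => [/H //|/ltW /H] + sL tL => /(_ tL sL).
rewrite !in_itv/= => /andP[s0 sL] /andP[t0 tL].
have dst (x : R) : x \in `]s, t[ -> is_derive x 1 u 0.
  rewrite in_itv/= => /andP[sx xt]; apply: du.
  by rewrite in_itv/= (le_lt_trans s0 sx) (lt_le_trans xt tL).
have cst : {within `[s, t], continuous u}.
  apply: continuous_subspaceW cu => x/=; rewrite /dom/= !in_itv/= => /andP[sx xt].
  by rewrite (le_trans s0 sx) (le_trans xt tL).
have [x _] := @MVT_segment R u (fun=> 0) s t st dst cst.
by rewrite mul0r => /eqP; rewrite subr_eq0 => /eqP ->.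
Qed.

Lemma continuous_primitive {R : realType} (g : R -> R) : continuous g ->
  exists F : R -> R, forall x : R, is_derive x 1 F (g x).
Proof.
move=> cg.
pose mu := @lebesgue_measure R.
have ig a b : mu.-integrable `[a, b] (EFin \o g).
  apply: continuous_compact_integrable; first exact: segment_compact.
  exact: continuous_subspaceT.
pose I a x := \int[mu]_(t in `[a, x]) g t.
have IB a b x : b <= a -> a <= x -> I b x - I b a = I a x.
  move=> ba ax; rewrite /I Rintegral_itvB// ?bnd_simp//.
  rewrite -Rintegral_itv_obnd_cbnd//; apply: integrableS (ig a x) => //.
  exact: subset_itv_oc_cc.
have dI (a x : R) : a < x -> is_derive x 1 (I a) (g x).
  move=> ax; have [d dE] := @continuous_FTC1_closed _ g a x (x + 1)
    ltac:(by rewrite ltrDl) (ig _ _) ax (cg x).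
  by rewrite -dE derive1E; exact: derivableP.
(* Any base point to the left of both x and 0 yields the same difference, so the dependence of the
   base point on x is harmless. *)
pose F (x : R) := I (- (`|x| + 1)) x - I (- (`|x| + 1)) 0.
exists F => x.
(* For |x - y| < 1/2 this fixed base point satisfies -(|y| + 1) <= a <= y, so near x the primitive
   equals [I a] up to a constant. *)
pose a : R := - (`|x| + 1 / 2).
have := dI a x; have ax : a < x.
  rewrite /a; have := ler_norm (- x); rewrite normrN; lra.
move=> /(_ ax) dax.
have : is_derive x 1 (I a - cst (I a 0)) (g x).
  by apply: is_derive_eq; rewrite subr0.
apply: near_eq_is_derive; near=> y.
have yx : `|x - y| < 1 / 2 by near: y; apply: nbhsx_ballx; rewrite divr_gt0.
have yx2 : `|x| <= `|y| + `|x - y| by have := ler_normD (x - y) y; rewrite subrK; lra.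
have ay : a <= y.
  by rewrite /a; have := ler_norm (- x); move: yx; rewrite normrN ltr_norml; lra.
have a0 : a <= 0 by have := normr_ge0 x; rewrite /a; lra.
have ba : - (`|y| + 1) <= a by rewrite /a; lra.
by rewrite /F -[LHS]/(I a y - I a 0) -(IB a _ y ba ay) -(IB a _ 0 ba a0); ring.
Unshelve. all: by end_near. Qed.

(** By compactness of [0, L] in its near-covering form, it suffices to treat pairs (x, e) close to
    (s, 0). There both g(x + e) and g(x) are within d/2 of g(s). *)
Lemma uniform_shift {R : realType} (L d : R) (g : R -> R) : continuous g ->
  0 < d -> \forall e \near 0, forall s, s \in `[0, L] -> `|g (s + e) - g s| <= d.
Proof.
move=> cg d0.
have /compact_near_coveringP cL := @segment_compact R 0 L.
have := cL R (nbhs 0) (fun e s => `|g (s + e) - g s| <= d) _.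
apply => s _.
have /cvgrPdist_lt/(_ (d / 2)) := cg s; rewrite divr_gt0// => /(_ isT) gs.
have gse : \forall x \near s & e \near (0 : R), `|g s - g (x + e)| < d / 2.
  have : (fun z : R * R => z.1 + z.2) @ (s, 0 : R) --> s + 0.
    by apply: cvgD; [exact: cvg_fst|exact: cvg_snd].
  by rewrite addr0 => /(_ _ gs).
have gsx : \forall x \near s & e \near (0 : R), `|g s - g x| < d / 2.
  exact: (@cvg_fst _ _ (nbhs s) (nbhs (0 : R)) _ _ gs).
by apply: filterS2 gsx gse => -[x e] /=; rewrite !ltr_norml ler_norml; lra.
Qed.

(** * Global extension of a curve with prescribed curvature *)

(* [(X, Y)] is the curve, [(A, B)] its unit tangent and [phi] its signed
   curvature. *)
Definition frenet {R : realType} (phi X Y A B : R -> R) : Prop :=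
  [/\ continuous phi, forall s : R, A s ^+ 2 + B s ^+ 2 = 1,
      forall s : R, is_derive s 1 X (A s), forall s : R, is_derive s 1 Y (B s) &
      forall s : R, is_derive s 1 A (- (phi s * B s)) /\
                    is_derive s 1 B (phi s * A s)].

Lemma is_derive_shift_comp {R : realType} (u : R -> R) (e s d : R) :
  is_derive (s + e) 1 u d -> is_derive s 1 (fun t => u (t + e)) d.
Proof.
move=> du; have := @is_derive1_comp R u (shift e) s d 1 du (is_derive_shift _ _ _).
by rewrite mulr1.
Qed.

Lemma is_derive_reflect {R : realType} (u : R -> R) (e s d : R) :
  is_derive (e - s) 1 u d -> is_derive s 1 (fun t => u (e - t)) (- d).
Proof.
move=> du; have dr : is_derive s 1 (cst e - id : R -> R) (- 1).
  by apply: is_derive_eq; rewrite sub0r.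
by have := @is_derive1_comp R u (cst e - id) s d (- 1) du dr; rewrite mulrN1.
Qed.

(** The differences K(s + L) - K(s) and K(L - s) - K(s) both have zero derivative. The second
    vanishes at L/2, hence K(L) = K(0), which is the constant value of the first. *)
Lemma periodic_odd_primitive {R : realType} (L : R) (phi K : R -> R) :
  (forall s, phi (- s) = - phi s) -> (forall s, phi (s + L) = phi s) ->
  (forall s : R, is_derive s 1 K (phi s)) -> forall s, K (s + L) = K s.
Proof.
move=> phiN phiL dK s.
have dper (x : R) : is_derive x 1 ((fun t => K (t + L)) - K) 0.
  by have := is_derive_shift_comp (dK (x + L)) => dKL; apply: is_derive_eq;
    rewrite phiL subrr.
(* [phi] is odd about [L / 2], so [K] is symmetric about [L / 2]. *)
have dsym (x : R) : is_derive x 1 ((fun t => K (L - t)) - K) 0.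
  have := is_derive_reflect (dK (L - x)) => dKL; apply: is_derive_eq.
  by rewrite (addrC L) phiL phiN opprK subrr.
apply/eqP; rewrite -subr_eq0; apply/eqP.
rewrite -[LHS]/(((fun t => K (t + L)) - K) s) (is_derive_0_is_cst s 0 dper).
rewrite -[LHS]/(K (0 + L) - K 0) add0r.
have := is_derive_0_is_cst 0 (L / 2) dsym.
rewrite -[LHS]/(K (L - 0) - K 0) -[RHS]/(K (L - L / 2) - K (L / 2)) subr0 => ->.
by rewrite {1}(splitr L) addrK subrr.
Qed.

(** The tangent (A, B) is the initial tangent of the curve rotated by the turning angle K,
    normalized by K(0) = 0, so its periodicity is inherited from that of K. The curve (X, Y) is then
    a primitive starting at [gamma 0]. No angle function has to be lifted from the given curve: its
    tangent is identified with (A, B) by uniqueness for a linear system. *)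
Lemma frenet_extension {R : realType} (L : R) (phi k : R -> R) (gamma : R -> R * R) :
  0 < L -> continuous phi ->
  (forall s, phi (- s) = - phi s) -> (forall s, phi (s + L) = phi s) ->
  (forall s, dom L s -> k s = phi s) -> signed_curvature L gamma k ->
  exists X Y A B : R -> R, [/\ frenet phi X Y A B,
    forall s, A (s + L) = A s, forall s, B (s + L) = B s &
    forall s, dom L s -> gamma s = (X s, Y s)].
Proof.
move=> L0 cphi phiN phiL kphi [g1 [g2 [C1g C1g1 g1_unit g2E]]].
have [K0 dK0] := continuous_primitive cphi.
pose K := K0 - cst (K0 0).
have dK (s : R) : is_derive s 1 K (phi s).
  by have := dK0 s => dK0s; apply: is_derive_eq; rewrite subr0.
have K_0 : K 0 = 0 by rewrite -[LHS]/(K0 0 - K0 0) subrr.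
have KL := periodic_odd_primitive phiN phiL dK.
have domoo (s : R) : s \in `]0, L[ -> dom L s.
  by move=> sL; rewrite /dom/=; exact: subset_itv_oo_cc sL.
have dom0 : dom L 0 by rewrite /dom/= in_itv/= lexx ltW.
set a := (g1 0).1; set b := (g1 0).2.
pose A := a \*: (cos \o K) - b \*: (sin \o K).
pose B := a \*: (sin \o K) + b \*: (cos \o K).
have AE s : A s = a * cos (K s) - b * sin (K s) by [].
have BE s : B s = a * sin (K s) + b * cos (K s) by [].
have dA (s : R) : is_derive s 1 A (- (phi s * B s)).
  have := dK s => dKs; apply: is_derive_eq; rewrite BE /GRing.scale/=; ring.
have dB (s : R) : is_derive s 1 B (phi s * A s).
  have := dK s => dKs; apply: is_derive_eq; rewrite AE /GRing.scale/=; ring.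
have ab1 : a ^+ 2 + b ^+ 2 = 1.
  have := g1_unit 0 dom0; rewrite /enorm -/a -/b => E.
  by rewrite -[LHS]sqr_sqrtr ?addr_ge0 ?sqr_ge0// E expr1n.
have AB1 s : A s ^+ 2 + B s ^+ 2 = 1.
  rewrite AE BE -[RHS]mulr1 -{1}ab1 -(cos2Dsin2 (K s)); ring.
have [X0 dX0] := continuous_primitive (is_derive_continuous dA).
have [Y0 dY0] := continuous_primitive (is_derive_continuous dB).
pose X := X0 + cst ((gamma 0).1 - X0 0).
pose Y := Y0 + cst ((gamma 0).2 - Y0 0).
have dX (s : R) : is_derive s 1 X (A s).
  by have := dX0 s => dXs; apply: is_derive_eq; rewrite addr0.
have dY (s : R) : is_derive s 1 Y (B s).
  by have := dY0 s => dXs; apply: is_derive_eq; rewrite addr0.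
have X_0 : X 0 = (gamma 0).1 by rewrite -[LHS]/(X0 0 + (_ - X0 0)) addrC subrK.
have Y_0 : Y 0 = (gamma 0).2 by rewrite -[LHS]/(Y0 0 + (_ - Y0 0)) addrC subrK.
have A_0 : A 0 = a by rewrite AE K_0 cos0 sin0 mulr0 mulr1 subr0.
have B_0 : B 0 = b by rewrite BE K_0 cos0 sin0 mulr0 mulr1 add0r.
have [cg1x cg2x dg1x] := C1_deriv_fst C1g1.
have [cg1y cg2y dg1y] := C1_deriv_snd C1g1.
have [cgx _ dgx] := C1_deriv_fst C1g.
have [cgy _ dgy] := C1_deriv_snd C1g.
have cw (u g : R -> R) : (forall s : R, is_derive s 1 u (g s)) -> {within dom L, continuous u}.
  by move=> du; apply: continuous_subspaceT; exact: is_derive_continuous du.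
(* Both unit tangents solve the linear system [v' = phi rot90 v], which preserves
   the distance [D] between solutions. *)
pose D := ((fst \o g1) - A) * ((fst \o g1) - A) + ((snd \o g1) - B) * ((snd \o g1) - B).
have DE s : D s = ((g1 s).1 - A s) ^+ 2 + ((g1 s).2 - B s) ^+ 2 by rewrite !expr2.
have cD : {within dom L, continuous D}.
  have cgA : {within dom L, continuous (fst \o g1 - A)}.
    by apply: within_continuousB => //; exact: cw dA.
  have cgB : {within dom L, continuous (snd \o g1 - B)}.
    by apply: within_continuousB => //; exact: cw dB.
  by apply: within_continuousD => x; apply: continuousM; [exact: cgA|exact: cgA|exact: cgB|exact: cgB].
have dD (s : R) : s \in `]0, L[ -> is_derive s 1 D 0.
  move=> sL; have := dg1x s sL; have := dg1y s sL; have := dA s; have := dB s.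
  have sdom := domoo s sL.
  rewrite /= (g2E s sdom) (kphi s sdom) /= => dBs dAs dg1ys dg1xs.
  apply: is_derive_eq.
  set x := (g1 s).1; set y := (g1 s).2.
  rewrite -[LHS]/((x - A s) * (phi s * - y - - (phi s * B s)) +
    (x - A s) * (phi s * - y - - (phi s * B s)) +
    ((y - B s) * (phi s * x - phi s * A s) + (y - B s) * (phi s * x - phi s * A s))).
  move: x y (A s) (B s) (phi s) => x y As Bs ps; ring.
have D0 s : s \in `[0, L] -> D s = 0.
  move=> sL; rewrite (C1_deriv0_cst cD dD sL (t := 0)) ?in_itv/= ?lexx ?ltW//.
  by rewrite DE A_0 B_0 !subrr expr0n addr0.
have g1E s : s \in `[0, L] -> (g1 s).1 = A s /\ (g1 s).2 = B s.
  move=> /D0/eqP; rewrite DE paddr_eq0 ?sqr_ge0// !sqrf_eq0 !subr_eq0.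
  by move=> /andP[/eqP -> /eqP ->].
have gX s : s \in `[0, L] -> (gamma s).1 = X s.
  move=> sL; apply/eqP; rewrite -subr_eq0; apply/eqP.
  rewrite -[LHS]/(((fst \o gamma) - X) s).
  rewrite (C1_deriv0_cst _ _ sL dom0).
  - by rewrite -[LHS]/((gamma 0).1 - X 0) X_0 subrr.
  - by apply: within_continuousB => //; exact: cw dX.
  - move=> t tL; have := dgx t tL; have := dX t => dXt dgt; apply: is_derive_eq.
    by have [/= -> _] := g1E t (domoo t tL); rewrite subrr.
have gY s : s \in `[0, L] -> (gamma s).2 = Y s.
  move=> sL; apply/eqP; rewrite -subr_eq0; apply/eqP.
  rewrite -[LHS]/(((snd \o gamma) - Y) s).
  rewrite (C1_deriv0_cst _ _ sL dom0).
  - by rewrite -[LHS]/((gamma 0).2 - Y 0) Y_0 subrr.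
  - by apply: within_continuousB => //; exact: cw dY.
  - move=> t tL; have := dgy t tL; have := dY t => dXt dgt; apply: is_derive_eq.
    by have [_ /= ->] := g1E t (domoo t tL); rewrite subrr.
exists X, Y, A, B; split => [|s|s|s sL].
- by split.
- by rewrite !AE KL.
- by rewrite !BE KL.
- by rewrite [LHS]surjective_pairing gX// gY.
Qed.

(** * Test functions *)

(** Squaring makes the positive part differentiable at the corner: at 0 its difference quotient is
    the positive part itself, a continuous function vanishing there. *)
Lemma is_derive_sqr_pos {R : realType} (x : R) :
  is_derive x 1 (fun y : R => Num.max y 0 ^+ 2) (2 * Num.max x 0).
Proof.
have [x0|x0|->] := ltgtP x 0.
- rewrite mulr0; apply: near_eq_is_derive (is_derive_cst (0 : R) x 1).
  near=> y; rewrite /cst max_r ?expr0n//.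
  have : y \in `]-oo, 0[ by near: y; apply: near_in_itvNyo; rewrite in_itv.
  by rewrite in_itv/= => /ltW.
- have d2 : is_derive x 1 (id ^+ 2 : R -> R) (2 * x).
    by apply: is_derive_eq; rewrite /GRing.scale/= expr1 mulr1.
  apply: near_eq_is_derive d2; near=> y; rewrite max_l//.
  have : y \in `]0, +oo[ by near: y; apply: near_in_itvoy; rewrite in_itv/= x0.
  by rewrite in_itv/= andbT => /ltW.
- apply/is_derive1_caratheodory; exists (fun y => Num.max y 0); split.
  + move=> z; rewrite subr0 maxxx expr0n/= subr0.
    by have [z0|z0] := leP z 0; rewrite ?mul0r ?expr0n// expr2.
  + by apply: continuous_max; [exact: cvg_id|exact: cvg_cst].
  + by rewrite maxxx mulr0.
Unshelve. all: by end_near. Qed.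

Lemma test_function_intro {R : realType} (L a b : R) (phi psi : R -> R) :
  0 < a -> b < L -> (forall x : R, is_derive x 1 phi (psi x)) -> continuous psi ->
  (forall x, x \notin `[a, b] -> phi x = 0) -> test_function L phi.
Proof.
move=> a0 bL dphi cpsi phi0; split.
- by move=> x; case: (dphi x).
- suff -> : derive1 phi = psi by [].
  by apply/funext => x; rewrite derive1E; case: (dphi x) => _ <-.
- by exists a, b.
Qed.

Section plateau.
Context {R : realType}.
Variables (a b : R).
Let q (x : R) : R := (x - a) * (b - x).
Let w (x : R) : R := Num.max (q x) 0 ^+ 2.

(** For a < b, [w] is C^1 and positive exactly on ]a, b[. Hence this function vanishes off ]a, b[
    for every n and tends to 1 inside as n grows. *)
Definition plateau (n : nat) (x : R) : R := 1 - (1 + n%:R * w x)^-1.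

Let w_ge0 x : 0 <= w x. Proof. exact: sqr_ge0. Qed.

Let nw_ge1 n x : 1 <= 1 + n%:R * w x.
Proof. by rewrite lerDl mulr_ge0. Qed.

Let nw_gt0 n x : 0 < 1 + n%:R * w x.
Proof. exact: lt_le_trans (nw_ge1 n x). Qed.

Lemma plateau_ge0 n x : 0 <= plateau n x.
Proof. by rewrite subr_ge0 invf_le1. Qed.

Lemma plateau_le1 n x : plateau n x <= 1.
Proof. by rewrite gerBl invr_ge0 ltW. Qed.

Lemma plateau_out n x : a < b -> x \notin `]a, b[ -> plateau n x = 0.
Proof.
move=> ab xab; rewrite /plateau /w max_r ?expr0n/= ?mulr0 ?addr0 ?invr1 ?subrr//.
move: xab; rewrite in_itv/= negb_and -!leNgt /q => /orP[xa|bx].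
  by rewrite mulr_le0_ge0 ?subr_le0// subr_ge0 (le_trans xa)// ltW.
by rewrite mulr_ge0_le0 ?subr_le0// subr_ge0 (le_trans _ bx)// ltW.
Qed.

Lemma plateau_cvg x : x \in `]a, b[ -> plateau n x @[n --> \oo] --> (1 : R).
Proof.
move=> /andP[]; rewrite !bnd_simp => ax xb.
have w0 : 0 < w x.
  by rewrite exprn_even_gt0//= max_l ?mulf_neq0 ?mulr_ge0 ?subr_ge0 ?ltW//
    subr_eq0 ?gt_eqF.
rewrite -[X in _ --> X]subr0; apply: cvgB; first exact: cvg_cst.
apply/gtr0_cvgV0; first by near=> n; exact: nw_gt0.
apply/cvgryPge => M; near=> n.
rewrite (le_trans (_ : _ <= n%:R * w x)) ?lerDr// -ler_pdivrMr//.
by near: n; exact: nbhs_infty_ger.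
Unshelve. all: by end_near. Qed.

Definition dplateau (n : nat) (x : R) : R :=
  (1 + n%:R * w x) ^- 2 * (n%:R * (2 * Num.max (q x) 0 * ((b - x) - (x - a)))).

Lemma is_derive_plateau n (x : R) : is_derive x 1 (plateau n) (dplateau n x).
Proof.
have dq : is_derive x 1 ((id - cst a) * (cst b - id) : R -> R) ((b - x) - (x - a)).
  apply: is_derive_eq.
  by rewrite -[LHS]/((x - a) * (0 - 1) + (b - x) * (1 - 0)); ring.
have dw : is_derive x 1 w (2 * Num.max (q x) 0 * ((b - x) - (x - a))).
  exact: (@is_derive1_comp _ _ _ x _ _ (is_derive_sqr_pos (q x)) dq).
have dnw : is_derive x 1 (cst 1 + n%:R \*: w) (n%:R * (2 * Num.max (q x) 0 * ((b - x) - (x - a)))).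
  by apply: is_derive_eq; rewrite add0r.
have dV := @is_deriveV R (cst 1 + n%:R \*: w) x _ 1 (lt0r_neq0 (nw_gt0 n x)) dnw.
have : is_derive x 1 (cst 1 - (fun y : R => ((cst 1 + n%:R \*: w) y)^-1)) (dplateau n x).
  by apply: is_derive_eq; rewrite sub0r scaleNr opprK.
by [].
Qed.

Lemma continuous_dplateau n : continuous (dplateau n).
Proof.
move=> x.
have cq : {for x, continuous q}.
  by apply: continuousM; apply: continuousB => //; exact: cvg_cst.
have cm : {for x, continuous (fun y => Num.max (q y) 0)}.
  by apply: continuous_max => //; exact: cvg_cst.
apply: cvgM.
  apply: cvgV; first by rewrite expf_neq0// lt0r_neq0.
  apply: cvgM; (apply: cvgD; [exact: cvg_cst|apply: cvgM; [exact: cvg_cst|exact: cvgM]]).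
apply: cvgM; first exact: cvg_cst.
apply: cvgM; first by apply: cvgM => //; exact: cvg_cst.
by apply: cvgB; apply: cvgB => //; exact: cvg_cst.
Qed.

Lemma test_function_plateau (L : R) n : 0 < a -> a < b -> b < L ->
  test_function L (plateau n).
Proof.
move=> a0 ab bL; apply: (test_function_intro a0 bL (is_derive_plateau n)).
  exact: continuous_dplateau.
by move=> x xab; apply: plateau_out => //; apply: contra xab; exact: subset_itv_oo_cc.
Qed.

End plateau.

(** * The fundamental lemma of the calculus of variations on [0, L] *)

Lemma measurable_dom {R : realType} (L : R) : measurable (dom L : set (measurableTypeR R)).
Proof. exact: measurable_itv. Qed.
#[local] Hint Resolve measurable_dom : core.

Lemma continuous_integrable_dom {R : realType} (L : R) (u : R -> R) :
  {within dom L, continuous u} -> (@lebesgue_measure R).-integrable (dom L) (EFin \o u).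
Proof. by move=> cu; apply: continuous_compact_integrable => //; exact: segment_compact. Qed.

Lemma integrable_mul_continuous {R : realType} (L : R) (u psi : R -> R) :
  (@lebesgue_measure R).-integrable (dom L) (EFin \o u) ->
  {within dom L, continuous psi} ->
  (@lebesgue_measure R).-integrable (dom L) (EFin \o (fun x => u x * psi x)).
Proof.
move=> iu cpsi.
rewrite (_ : EFin \o _ = ((EFin \o u) \* (EFin \o psi))%E); last first.
  by apply/funext => x /=; rewrite EFinM.
apply: integrableMl => //.
  apply: subspace_continuous_measurable_fun => //; exact: measurable_dom.
have /compact_bounded[M [Mr MP]] := continuous_compact cpsi (@segment_compact R 0 L).
exists M; split => // N MN x /= xL; apply: (MP N MN); exists x => //.
Qed.

Lemma test_function_within {R : realType} (L : R) (phi : R -> R) :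
  test_function L phi ->
  {within dom L, continuous phi} /\ {within dom L, continuous (derive1 phi)}.
Proof.
move=> [dphi cphi _]; split; apply: continuous_subspaceT => //.
move=> x; apply/differentiable_continuous/derivable1_diffP; exact: dphi.
Qed.

Section orthogonality.
Context {R : realType}.
Variables (L : R) (g : R -> R).
Notation mu := (@lebesgue_measure R).
Hypothesis ig : mu.-integrable (dom L) (EFin \o g).
Hypothesis g_ortho : forall phi, test_function L phi ->
  \int[mu]_(x in dom L) (g x * phi x) = 0.

(** Plateau functions lie between 0 and 1 and converge to the indicator of ]a, b[, so |g| dominates
    and the limit of the zero integrals is the integral over the interval. *)
Lemma orthogonal_itv0 a b : 0 < a -> a < b -> b < L ->
  \int[mu]_(x in `]a, b[) g x = 0.
Proof.
move=> a0 ab bL.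
have tf n := @test_function_plateau R a b L n a0 ab bL.
have [mg _] := integrableP _ _ _ ig.
pose f_ n x := (g x * plateau a b n x)%:E.
have if_ n : mu.-integrable (dom L) (f_ n).
  by apply: integrable_mul_continuous => //; case: (test_function_within (tf n)).
have mgab : measurable_fun (dom L) (EFin \o (g \_ `]a, b[)).
  rewrite -restrict_EFin.
  apply: (measurable_restrict _ (measurable_itv _) (measurable_dom L)).1.
  by apply: (measurable_funS (measurable_dom L)) mg => x [].
have f_g x n : dom L x -> (`|f_ n x| <= `|(EFin \o g) x|)%E.
  move=> _; rewrite /f_ /= lee_fin normrM ler_piMr//.
  by rewrite ger0_norm ?plateau_ge0 ?plateau_le1.
have f_f x : dom L x -> f_ ^~ x @ \oo --> (EFin \o (g \_ `]a, b[)) x.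
  move=> _; apply/cvg_EFin; first by near=> n.
  rewrite patchE; case: ifPn => xab.
    rewrite -[X in _ --> X]mulr1; apply: cvgM; first exact: cvg_cst.
    by apply: plateau_cvg; rewrite inE in xab.
  rewrite (_ : _ \o _ = cst 0); first exact: cvg_cst.
  apply/funext => n /=; rewrite plateau_out ?mulr0//.
  by apply: contra xab; rewrite inE.
have [] := @dominated_convergence _ _ _ mu _ (@measurable_dom R L) f_
  (EFin \o (g \_ `]a, b[)) (abse \o (EFin \o g)).
- by move=> n; exact: measurable_int (if_ n).
- exact: mgab.
- by apply: aeW => x; exact: f_f.
- exact: integrable_abse.
- by apply: aeW => x n; exact: f_g.
move=> _ _.
rewrite (_ : [sequence _]_n = cst 0%E); last first.
  apply/funext => n /=; rewrite -[LHS]fineK; last exact: (integrable_fin_num (@measurable_dom R L) (if_ n)).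
  by congr EFin; exact: g_ortho (tf n).
move=> /(cvg_unique (@ereal_hausdorff R) (cvg_cst _)) g0.
have abL : dom L `&` `]a, b[ = `]a, b[%classic.
  apply/setIidr => x /=; rewrite /dom/= !in_itv/= => /andP[ax xb].
  by rewrite !ltW// ?(lt_trans xb)// (lt_trans a0).
rewrite -abL Rintegral_mkcondr /Rintegral.
by have := congr1 fine g0 => /= <-.
Unshelve. all: by end_near. Qed.

(** By Lebesgue differentiation, g is almost everywhere the derivative of its indefinite integral F,
    and F is constant on ]0, L[ because integrals over inner intervals vanish. The endpoints, where
    this says nothing, form a null set. *)
Lemma orthogonal_ae0 : {ae mu, forall x, dom L x -> g x = 0}.
Proof.
pose g0 := g \_ (dom L).
have ig0 : mu.-integrable setT (EFin \o g0).
  by rewrite -restrict_EFin; apply/integrable_restrict => //; rewrite setTI.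
have ig0y y : mu.-integrable `]-oo, y] (EFin \o g0).
  by apply: integrableS ig0.
have lg0 : locally_integrable [set: R] g0 by exact: (integrable_locally (measurable_dom L) ig).
have := FTC1Ny ig0y lg0.
have n0 : {ae mu, forall x, ~ ([set 0; L] : set R) x}.
  exists [set 0; L]; split.
  - by apply: measurableU; exact: measurable_set1.
  - by apply: countable_lebesgue_measure0; exact/finite_set_countable.
  - by move=> x /= /contrapT.
move: n0; apply: filterS2; first exact: (ae_filter_ringOfSetsType mu).
move=> x /= /not_orP[x0 xL] [_ dF].
rewrite /dom/= in_itv/= => /andP[].
rewrite le_eqVlt => /predU1P[/esym//|{}x0]; rewrite le_eqVlt => /predU1P[//|{}xL].
have xdom : dom L x by rewrite /dom/= in_itv/= !ltW.
rewrite (_ : g x = g0 x); last by rewrite /g0 patchE mem_set.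
rewrite -dF derive1E.
set F := (fun y : R => _).
have Fcst y z : 0 < y -> y < z -> z < L -> F z = F y.
  move=> y0 yz zL; apply/eqP; rewrite -subr_eq0 /F Rintegral_itvB// ?bnd_simp ?ltW//.
  rewrite -Rintegral_itv_bndo_bndc; last by apply: integrableS ig0.
  apply/eqP; rewrite -[RHS](orthogonal_itv0 y0 yz zL).
  apply: eq_Rintegral => t; rewrite inE/= in_itv/= => /andP[yt tz].
  by rewrite /g0 patchE mem_set// /dom/= in_itv/= !ltW// ?(lt_trans tz)// (lt_trans y0).
have : is_derive x 1 F 0.
  apply: near_eq_is_derive (is_derive_cst (F x) x 1); near=> y.
  have : y \in `]0, L[ by near: y; apply: near_in_itvoo; rewrite in_itv/= x0 xL.
  rewrite in_itv/= => /andP[y0 yL]; rewrite /cst.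
  have [xy|yx|->//] := ltgtP x y; first exact/esym/Fcst.
  exact: Fcst.
by case.
Unshelve. all: by end_near. Qed.

End orthogonality.

(** * Weak derivatives *)

Lemma ae_imply {R : realType} (P Q : R -> Prop) :
  (forall x, P x -> Q x) -> {ae @lebesgue_measure R, forall x, P x} ->
  {ae @lebesgue_measure R, forall x, Q x}.
Proof. by move=> PQ; apply: filterS; first exact: (ae_filter_ringOfSetsType (@lebesgue_measure R)). Qed.

Lemma ae_imply2 {R : realType} (P Q S : R -> Prop) :
  (forall x, P x -> Q x -> S x) -> {ae @lebesgue_measure R, forall x, P x} ->
  {ae @lebesgue_measure R, forall x, Q x} -> {ae @lebesgue_measure R, forall x, S x}.
Proof. by move=> PQ; apply: filterS2; first exact: (ae_filter_ringOfSetsType (@lebesgue_measure R)). Qed.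

Section weak_derivative_theory.
Context {R : realType}.
Variable L : R.
Notation mu := (@lebesgue_measure R).
Notation ae_eq_dom u v := {ae mu, forall x, dom L x -> u x = v x}.

Lemma ae_eq_Rintegral_dom (u v : R -> R) :
  mu.-integrable (dom L) (EFin \o u) -> mu.-integrable (dom L) (EFin \o v) ->
  ae_eq_dom u v -> \int[mu]_(x in dom L) u x = \int[mu]_(x in dom L) v x.
Proof.
move=> iu iv uv; rewrite /Rintegral; congr fine.
apply: (@ae_eq_integral _ _ _ mu _ _ _ (@measurable_dom R L)).
- exact: measurable_int iu.
- exact: measurable_int iv.
- by apply: ae_imply uv => x uvx xL; rewrite /= uvx.
Qed.

Lemma weak_derivative_unique (u g h : R -> R) :
  weak_derivative L u g -> weak_derivative L u h -> ae_eq_dom g h.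
Proof.
move=> [iu ig ug] [_ ih uh].
have igh : mu.-integrable (dom L) (EFin \o (fun x => g x - h x)).
  by apply: (eq_integrable (measurable_dom L) _ _ _ (integrableB (measurable_dom L) ig ih)).
have := orthogonal_ae0 igh.
have gh0 phi : test_function L phi ->
    \int[mu]_(x in dom L) ((g x - h x) * phi x) = 0.
  move=> tphi; have [cphi _] := test_function_within tphi.
  under eq_Rintegral do rewrite mulrBl.
  rewrite (RintegralB (measurable_dom L)); try exact: integrable_mul_continuous.
  by rewrite -[X in X - _]opprK -ug// uh// opprK subrr.
move=> /(_ gh0); apply: ae_imply => x gh /gh/eqP.
by rewrite subr_eq0 => /eqP.
Qed.

Lemma wderivP (u g : R -> R) : weak_derivative L u g -> weak_derivative L u (wderiv L u).
Proof. by move=> ug; exact: (@xgetPex _ (fun=> 0) [set g | weak_derivative L u g] (ex_intro _ g ug)). Qed.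

Lemma wderiv_ae (u g : R -> R) : weak_derivative L u g -> ae_eq_dom (wderiv L u) g.
Proof. by move=> ug; exact: weak_derivative_unique (wderivP ug) ug. Qed.

Lemma weak_derivative_congr (u v g : R -> R) :
  mu.-integrable (dom L) (EFin \o v) -> ae_eq_dom u v ->
  weak_derivative L u g -> weak_derivative L v g.
Proof.
move=> iv uv [iu ig ug]; split => // phi tphi; rewrite -ug//.
have [_ cphi] := test_function_within tphi.
apply: ae_eq_Rintegral_dom; try exact: integrable_mul_continuous.
by apply: ae_imply uv => x uvx xL; rewrite uvx.
Qed.

(** Both sides choose from the same set of weak derivatives, so the chosen representatives are equal
    everywhere and not just almost everywhere. This allows a curve to be replaced by its extension
    inside norms and energies. *)
Lemma wderiv_congr (u v : R -> R) : {in dom L, u =1 v} -> wderiv L u = wderiv L v.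
Proof.
move=> uv; rewrite /wderiv; congr (xget _ _); apply/seteqP; split => g.
  move=> [iu ig ug]; split => // [|phi tphi].
    by apply: (eq_integrable (measurable_dom L)) iu => // x xL; rewrite /= uv.
  by rewrite -ug//; apply: eq_Rintegral => x xL; rewrite uv.
move=> [iu ig ug]; split => // [|phi tphi].
  by apply: (eq_integrable (measurable_dom L)) iu => // x xL; rewrite /= uv.
by rewrite -ug//; apply: eq_Rintegral => x xL; rewrite uv.
Qed.

Lemma weak_derivativeB (u v g h : R -> R) :
  weak_derivative L u g -> weak_derivative L v h ->
  weak_derivative L (fun x => u x - v x) (fun x => g x - h x).
Proof.
move=> [iu ig ug] [iv ih vh]; split.
- by apply: (eq_integrable (measurable_dom L) _ _ _ (integrableB (measurable_dom L) iu iv)).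
- by apply: (eq_integrable (measurable_dom L) _ _ _ (integrableB (measurable_dom L) ig ih)).
move=> phi tphi; have [cphi cdphi] := test_function_within tphi.
under eq_Rintegral do rewrite mulrBl.
rewrite (RintegralB (measurable_dom L)); try exact: integrable_mul_continuous.
under [in RHS]eq_Rintegral do rewrite mulrBl.
rewrite (RintegralB (measurable_dom L)); try exact: integrable_mul_continuous.
by rewrite ug// vh// opprB opprK addrC.
Qed.

Hypothesis L0 : 0 < L.

(** Integration by parts; the boundary terms vanish because the test function is zero outside some
    [a, b] with 0 < a and b < L. *)
Lemma C1_deriv_weak (u g : R -> R) : C1_deriv L u g -> weak_derivative L u g.
Proof.
move=> [cu cg dug]; split; try exact: continuous_integrable_dom.
move=> phi tphi; have [cphi cdphi] := test_function_within tphi.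
have [dphi _ [a [b [a0 bL phi0]]]] := tphi.
have bnd (v : R -> R) : {within dom L, continuous v} ->
    {in `]0, L[, forall x, derivable v x 1} -> derivable_oo_LRcontinuous v 0 L.
  by move=> /(continuous_within_itvP _ L0)[_ v0 vL] dv; split.
rewrite /dom (@Rintegration_by_parts _ u phi g (derive1 phi) 0 L)//.
- rewrite !phi0; first by rewrite !mulr0 subrr sub0r.
  + by rewrite in_itv/= negb_and -!ltNge a0.
  + by rewrite in_itv/= negb_and -!ltNge bL orbT.
- by apply: bnd => // x xL; case: (dug x xL).
- by move=> x xL; rewrite derive1E; case: (dug x xL) => _ <-.
- by apply: bnd => // x xL; exact: dphi.
Qed.

(** For the second derivative, the weak derivative of [wderiv L u] minus g has to be transported
    along an almost everywhere equality to the representative chosen for the first derivative of u -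
    v. *)
Lemma W2p_sub_C2 (p : R) (u v g h : R -> R) : W2p p L u ->
  C1_deriv L v g -> C1_deriv L g h ->
  ae_eq_dom (wderiv L (fun x => u x - v x)) (fun x => wderiv L u x - g x) /\
  ae_eq_dom (wderiv L (wderiv L (fun x => u x - v x)))
    (fun x => wderiv L (wderiv L u) x - h x).
Proof.
move=> [[_ [u1 _ uu1]] [_ [u2 _ uu2]]] vg gh.
have D1 := weak_derivativeB (wderivP uu1) (C1_deriv_weak vg).
have D2 := weak_derivativeB (wderivP uu2) (C1_deriv_weak gh).
have E1 := wderiv_ae D1; split => //.
apply: wderiv_ae; apply: weak_derivative_congr D2.
  by case: (wderivP D1).
by apply: ae_imply E1 => x E xL; rewrite E.
Qed.

End weak_derivative_theory.

(** * The W^{2,p} norm *)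

Section Lp_norm_theory.
Context {R : realType}.
Variables p L : R.
Hypothesis p1 : 1 <= p.
Notation mu := (@lebesgue_measure R).

Let p0 : p != 0. Proof. by rewrite gt_eqF// (lt_le_trans _ p1). Qed.

Lemma Lp_normE (u : R -> R) :
  Lp_norm p L u = ((\int[mu]_(x in dom L) (`|u x| `^ p)%:E) `^ p^-1)%E.
Proof.
rewrite /Lp_norm unlock [in RHS]integral_mkcond; congr (_ `^ _)%E.
apply: eq_integral => x _; rewrite /= !patchE; case: ifPn => _ //=.
by rewrite normr0 powR0.
Qed.

Lemma Lp_norm_le (u v : R -> R) :
  measurable_fun (dom L) u -> measurable_fun (dom L) v ->
  {ae mu, forall x, dom L x -> `|u x| <= `|v x|} ->
  (Lp_norm p L u <= Lp_norm p L v)%E.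
Proof.
move=> mu_ mv uv; rewrite !Lp_normE.
have m (w : R -> R) : measurable_fun (dom L) w ->
    measurable_fun (dom L) (fun x => (`|w x| `^ p)%:E).
  move=> mw; apply/measurable_EFinP; apply: (measurableT_comp (measurable_powR _)).
  exact: measurableT_comp.
have i0 (w : R -> R) : (0 <= \int[mu]_(x in dom L) (`|w x| `^ p)%:E)%E.
  by apply: integral_ge0 => x _; rewrite lee_fin powR_ge0.
apply: gt0_ler_poweR.
- by rewrite invr_ge0 (le_trans _ p1).
- by rewrite in_itv/= i0 leey.
- by rewrite in_itv/= i0 leey.
apply: (ae_ge0_le_integral (measurable_dom L)).
- by move=> x _; rewrite lee_fin powR_ge0.
- exact: m.
- by move=> x _; rewrite lee_fin powR_ge0.
- exact: m.
apply: ae_imply uv => x uvx xL; rewrite lee_fin ge0_ler_powR ?nnegrE//.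
  by rewrite (le_trans _ p1).
exact: uvx.
Qed.

Lemma Lp_normD (u v : R -> R) :
  measurable_fun (dom L) u -> measurable_fun (dom L) v ->
  (Lp_norm p L (fun x => u x + v x)%R <= Lp_norm p L u + Lp_norm p L v)%E.
Proof.
move=> mu_ mv; rewrite /Lp_norm.
have -> : (fun x => u x + v x) \_ (dom L) = u \_ (dom L) \+ v \_ (dom L).
  by apply/funext => x; rewrite /= !patchE; case: ifPn; rewrite ?addr0.
by apply: minkowski_EFin => //; exact: (measurable_restrictT _ (measurable_dom L)).1.
Qed.

Hypothesis L0 : 0 <= L.

Lemma Lp_norm_cst (c : R) : 0 <= c -> Lp_norm p L (cst c) = (c * L `^ p^-1)%:E.
Proof.
move=> c0; rewrite Lp_normE.
have -> : (\int[mu]_(x in dom L) (`|cst c x|%R `^ p)%:E)%E = ((c `^ p)%:E * mu (dom L))%E.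
  by rewrite -(integral_cst mu (measurable_dom L)); apply: eq_integral => x _; rewrite /= ger0_norm.
rewrite lebesgue_measure_itv/= lte_fin.
move: L0; rewrite le_eqVlt => /predU1P[<-|L_gt0].
  by rewrite ltxx mule0 poweR0r ?invr_eq0// powR0 ?invr_eq0// mulr0.
rewrite L_gt0 oppr0 adde0 -EFinM poweR_EFin powRM ?powR_ge0//.
by rewrite -powRrM mulfV// powRr1.
Qed.

End Lp_norm_theory.

(** With s the norm of w, each |w_i| is at most s, so the squared norm of v is at most s^2 + 4ds +
    2d^2 <= (s + 2d)^2. The constant 2 is not sharp but avoids a square root. *)
Lemma enorm_le_add {R : realType} (v w : R * R) (d : R) :
  `|v.1 - w.1| <= d -> `|v.2 - w.2| <= d -> enorm v <= enorm w + (d + d).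
Proof.
rewrite /enorm; set s := Num.sqrt (w.1 ^+ 2 + _) => h1 h2.
have d0 : 0 <= d by exact: le_trans h1.
have s0 : 0 <= s by exact: sqrtr_ge0.
have ss : s ^+ 2 = w.1 ^+ 2 + w.2 ^+ 2 by rewrite sqr_sqrtr// addr_ge0 ?sqr_ge0.
have c1 : `|w.1| <= s by rewrite -sqrtr_sqr ler_wsqrtr// lerDl sqr_ge0.
have c2 : `|w.2| <= s by rewrite -sqrtr_sqr ler_wsqrtr// lerDr sqr_ge0.
rewrite -[leRHS]ger0_norm ?addr_ge0// -sqrtr_sqr ler_wsqrtr//.
have sq (t z : R) : `|t - z| <= d -> `|z| <= s -> t ^+ 2 <= z ^+ 2 + 2 * d * s + d ^+ 2.
  move=> tz zs; have : t ^+ 2 <= (`|z| + d) ^+ 2.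
    rewrite -[t ^+ 2]real_normK ?num_real// lerXn2r ?nnegrE ?addr_ge0//.
    by rewrite -[t](subrK z) addrC (le_trans (ler_normD _ _))// lerD2l.
  rewrite sqrrD real_normK ?num_real//.
  have := ler_wpM2r d0 zs; rewrite -mulr_natl; nra.
have := sq _ _ h1 c1; have := sq _ _ h2 c2; nra.
Qed.

Lemma enorm_ge0 {R : realType} (v : R * R) : 0 <= enorm v.
Proof. exact: sqrtr_ge0. Qed.

Lemma measurable_enorm {R : realType} (D : set R) (v : R -> R * R) :
  measurable_fun D (fst \o v) -> measurable_fun D (snd \o v) ->
  measurable_fun D (enorm \o v).
Proof.
move=> m1 m2.
rewrite (_ : enorm \o v = Num.sqrt \o (fun x => (fst \o v) x ^+ 2 + (snd \o v) x ^+ 2))//.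
apply: measurableT_comp.
  by apply: continuous_measurable_fun; exact: sqrt_continuous.
by apply: measurable_funD; apply: measurable_funX.
Qed.

Lemma within_continuous_measurable {R : realType} (L : R) (u : R -> R) :
  {within dom L, continuous u} -> measurable_fun (dom L) u.
Proof. by move=> cu; apply: subspace_continuous_measurable_fun => //; exact: measurable_dom. Qed.

Section W2p_C2.
Context {R : realType}.
Variables p L : R.
Hypotheses (p1 : 1 <= p) (L0 : 0 < L).
Notation mu := (@lebesgue_measure R).

Lemma in_Lp_bounded (u : R -> R) (M : R) : 0 <= M ->
  measurable_fun (dom L) u -> {ae mu, forall x, dom L x -> `|u x| <= M} ->
  in_Lp p L u.
Proof.
move=> M0 mu_ uM; rewrite /in_Lp inE; apply/andP; split; rewrite inE /=.
  exact: (measurable_restrictT _ (measurable_dom L)).1.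
rewrite /finite_norm; apply: (@le_lt_trans _ _ (Lp_norm p L (cst M))).
  apply: Lp_norm_le => //.
  by apply: ae_imply uM => x uM xL; rewrite (le_trans (uM xL))// ler_norm.
by rewrite (Lp_norm_cst p1 (ltW L0) M0) ltry.
Qed.

(** Meant for [wderiv], which agrees with a continuous derivative only almost everywhere: the bound
    is inherited, while measurability comes from the integrability contained in
    [weak_derivative]. *)
Lemma in_Lp_ae_continuous (u v : R -> R) : measurable_fun (dom L) u ->
  {within dom L, continuous v} -> {ae mu, forall x, dom L x -> u x = v x} ->
  in_Lp p L u.
Proof.
move=> mu_ cv uv.
have /compact_bounded[M [Mr MP]] := continuous_compact cv (@segment_compact R 0 L).
apply: (@in_Lp_bounded u (`|M| + 1)) => //.
apply: ae_imply uv => x uvx xL; rewrite uvx//; apply: (MP (`|M| + 1)).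
  by rewrite (le_lt_trans (ler_norm M))// ltrDl.
by exists x.
Qed.

Lemma wderiv_C2 (u g h : R -> R) : C1_deriv L u g -> C1_deriv L g h ->
  [/\ {ae mu, forall x, dom L x -> wderiv L u x = g x},
      weak_derivative L (wderiv L u) h &
      {ae mu, forall x, dom L x -> wderiv L (wderiv L u) x = h x}].
Proof.
move=> ug gh; have wug := C1_deriv_weak L0 ug.
have E1 := wderiv_ae wug.
have D2 : weak_derivative L (wderiv L u) h.
  apply: weak_derivative_congr (C1_deriv_weak L0 gh); first by case: (wderivP wug).
  by apply: ae_imply E1 => x E xL; rewrite E.
by split => //; exact: wderiv_ae D2.
Qed.

Lemma measurable_weak (u g : R -> R) : weak_derivative L u g ->
  measurable_fun (dom L) u /\ measurable_fun (dom L) g.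
Proof. by move=> [iu ig _]; split; apply/measurable_EFinP; [exact: measurable_int iu|exact: measurable_int ig]. Qed.

Lemma W2p_C2 (u g h : R -> R) : C1_deriv L u g -> C1_deriv L g h -> W2p p L u.
Proof.
move=> ug gh; have wug := C1_deriv_weak L0 ug.
have [E1 D2 _] := wderiv_C2 ug gh.
have [cu cg _] := ug; have [_ ch _] := gh.
have cL (v : R -> R) : {within dom L, continuous v} -> in_Lp p L v.
  move=> cv; apply: (in_Lp_ae_continuous _ cv); first exact: within_continuous_measurable.
  exact: aeW.
split; split.
- exact: cL.
- by exists g => //; exact: cL.
- by apply: (in_Lp_ae_continuous _ cg E1); case: (measurable_weak (wderivP wug)).
- by exists h => //; exact: cL.
Qed.

End W2p_C2.

(** * Translation and periodicity *)

Section translation.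
Context {R : realType}.
Notation mu := (@lebesgue_measure R).
Local Open Scope ereal_scope.

Let tr (e : R) : measurableTypeR R -> measurableTypeR R := fun x => (x + e)%R.

Let mtr e : measurable_fun setT (tr e).
Proof. by apply: measurable_funD => //; exact: measurable_cst. Qed.

Let tr_preimage e a b (c d : bool) :
  tr e @^-1` [set` Interval (BSide c a) (BSide d b)] =
  [set` Interval (BSide c (a - e)%R) (BSide d (b - e)%R)].
Proof. by apply/seteqP; split => x /=; rewrite !in_itv/= ?lteifBlDr ?lteifBrDr. Qed.

(** The translated measure gives each half-open interval its length, and this characterizes Lebesgue
    measure. *)
Lemma lebesgue_measure_translation e (A : set R) : measurable A ->
  pushforward mu (tr e) A = mu A.
Proof.
move=> mA; apply/esym.
have := @lebesgue_measure_unique R (pushforward mu (tr e)).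
apply => //= _ [[a b]] _ <-.
rewrite /pushforward tr_preimage !lebesgue_measure_itv/= !lte_fin ltrD2r.
by case: ifPn => // _; rewrite -!EFinD; congr EFin; ring.
Qed.

Lemma ge0_integral_translation e a b (f : R -> \bar R) :
  measurable_fun setT f -> (forall x, 0 <= f x) ->
  \int[mu]_(x in `]a, b]) f (x + e)%R = \int[mu]_(x in `](a + e)%R, (b + e)%R]) f x.
Proof.
move=> mf f0.
rewrite -[in LHS](addrK e a) -[in LHS](addrK e b) -(tr_preimage e _ _ false false).
rewrite -(@ge0_integral_pushforward _ _ _ _ _ _ (mtr e) mu)//.
- by apply: eq_measure_integral => //= A mA _; exact: lebesgue_measure_translation.
- by apply: measurable_funS mf.
Qed.

(** The window ]e, L + e] splits at L, and periodicity moves the piece ]L, L + e] back to ]0, e].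
    Half-open intervals make the pieces disjoint; nonnegativity allows infinite values. *)
Lemma ge0_integral_periodic_shift (L e : R) (f : R -> \bar R) :
  (0 <= e <= L)%R -> measurable_fun setT f -> (forall x, 0 <= f x) ->
  (forall x, f (x + L)%R = f x) ->
  \int[mu]_(x in dom L) f (x + e)%R = \int[mu]_(x in dom L) f x.
Proof.
move=> /andP[e0 eL] mf f0 fL.
have mfe : measurable_fun setT (fun x : R => f (x + e)%R) by apply: measurableT_comp (mtr e).
rewrite /dom -!integral_itv_obnd_cbnd; [|by apply: measurable_funTS..].
rewrite ge0_integral_translation// add0r.
have split_itv (a b c : R) : (a <= b)%R -> (b <= c)%R ->
    \int[mu]_(x in `]a, c]) f x =
    \int[mu]_(x in `]a, b]) f x + \int[mu]_(x in `]b, c]) f x.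
  move=> ab bc; rewrite (@itv_bndbnd_setU _ _ _ (BRight b)) ?bnd_simp//.
  rewrite ge0_integral_setU//; first exact: measurable_funTS.
  apply/disj_setPRL => x /=; rewrite !in_itv/= => /andP[bx _].
  by apply/negP; rewrite negb_and -!ltNge bx orbT.
rewrite (split_itv e L (L + e)%R)// ?lerDl// (split_itv 0%R e L)// [RHS]addeC.
congr (_ + _).
rewrite -{1}(add0r L) (addrC L e) -ge0_integral_translation//.
by apply: eq_integral => x _; rewrite fL.
Qed.

End translation.

(** * Curves with a moving frame *)

Section frenet_curves.
Context {R : realType}.
Variables p L : R.
Hypotheses (p1 : 1 <= p) (L0 : 0 < L).
Notation mu := (@lebesgue_measure R).

Lemma wderivc_congr (u v : R -> R * R) : {in dom L, u =1 v} -> wderivc L u = wderivc L v.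
Proof.
move=> uv; rewrite /wderivc (@wderiv_congr _ _ (fst \o u) (fst \o v)).
  by rewrite (@wderiv_congr _ _ (snd \o u) (snd \o v))// => x xL /=; rewrite uv.
by move=> x xL /=; rewrite uv.
Qed.

Lemma Lp_norm_congr (u v : R -> R) : {in dom L, u =1 v} -> Lp_norm p L u = Lp_norm p L v.
Proof.
move=> uv; rewrite /Lp_norm; congr (Lnorm _ _ (EFin \o _)).
by apply/funext => x; rewrite !patchE; case: ifPn => // /uv.
Qed.

Lemma W2p_norm_congr (u v : R -> R * R) : {in dom L, u =1 v} ->
  W2p_norm p L u = W2p_norm p L v.
Proof.
move=> uv; rewrite /W2p_norm (wderivc_congr uv); congr (_ + _ + _)%E.
by apply: Lp_norm_congr => x xL /=; rewrite uv.
Qed.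

Lemma energy_congr (f : R -> \bar R) (u v : R -> R * R) : {in dom L, u =1 v} ->
  energy f L u = energy f L v.
Proof. by move=> uv; rewrite /energy /wcurvature (wderivc_congr uv). Qed.

Lemma Lp_norm_enorm_le (v w : R -> R * R) (d : R) : 0 <= d ->
  measurable_fun (dom L) (fst \o v) -> measurable_fun (dom L) (snd \o v) ->
  measurable_fun (dom L) (fst \o w) -> measurable_fun (dom L) (snd \o w) ->
  {ae mu, forall x, dom L x -> `|(v x).1 - (w x).1| <= d} ->
  {ae mu, forall x, dom L x -> `|(v x).2 - (w x).2| <= d} ->
  (Lp_norm p L (enorm \o v) <= Lp_norm p L (enorm \o w) + ((d + d) * L `^ p^-1)%:E)%E.
Proof.
move=> d0 mv1 mv2 mw1 mw2 vw1 vw2.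
have mw : measurable_fun (dom L) (enorm \o w) by exact: measurable_enorm.
have mc : measurable_fun (dom L) (cst (d + d)) by exact: measurable_cst.
rewrite -(Lp_norm_cst p1 (ltW L0)) ?addr_ge0//.
apply: le_trans (Lp_normD p1 mw mc); apply: Lp_norm_le => //.
- exact: measurable_enorm.
- exact: measurable_funD.
apply: ae_imply2 vw1 vw2 => x vw1 vw2 xL /=.
rewrite ger0_norm ?enorm_ge0// ger0_norm ?addr_ge0 ?enorm_ge0//.
by apply: enorm_le_add; [exact: vw1|exact: vw2].
Qed.

Lemma frenet_C1 (phi X Y A B : R -> R) : frenet phi X Y A B ->
  [/\ C1_deriv L X A, C1_deriv L A (fun s => - (phi s * B s)),
      C1_deriv L Y B & C1_deriv L B (fun s => phi s * A s)].
Proof.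
move=> [cphi _ dX dY dAB].
have dA s := (dAB s).1; have dB s := (dAB s).2.
have cA := is_derive_continuous dA; have cB := is_derive_continuous dB.
split; apply: is_derive_C1_deriv => // s.
- by apply: cvgN; apply: cvgM; [exact: cphi|exact: cB].
- by apply: cvgM; [exact: cphi|exact: cA].
Qed.

(** This replaces the triangle inequality: u - (X2, Y2) and u - (X1, Y1) involve the same chosen
    derivatives of u, which cancel almost everywhere and leave only differences of the smooth
    frames. The factor 6 is three norms times the 2d of [enorm_le_add]. The third bound concerns the
    products of curvature and tangent because these are, up to sign, the second derivatives. *)
Lemma W2p_norm_le (u : R -> R * R) (phi1 X1 Y1 A1 B1 phi2 X2 Y2 A2 B2 : R -> R) (d : R) :
  {within dom L, continuous u} -> W2p p L (fst \o u) -> W2p p L (snd \o u) ->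
  frenet phi1 X1 Y1 A1 B1 -> frenet phi2 X2 Y2 A2 B2 -> 0 <= d ->
  (forall s, dom L s -> `|X1 s - X2 s| <= d /\ `|Y1 s - Y2 s| <= d) ->
  (forall s, dom L s -> `|A1 s - A2 s| <= d /\ `|B1 s - B2 s| <= d) ->
  (forall s, dom L s -> `|phi1 s * B1 s - phi2 s * B2 s| <= d /\
                        `|phi1 s * A1 s - phi2 s * A2 s| <= d) ->
  (W2p_norm p L (fun s => (u s - (X2 s, Y2 s))%R) <=
   W2p_norm p L (fun s => (u s - (X1 s, Y1 s))%R) + (6 * d * L `^ p^-1)%:E)%E.
Proof.
move=> cu Wu1 Wu2 /frenet_C1[XA1 AA1 YB1 BB1] /frenet_C1[XA2 AA2 YB2 BB2] d0 dXY dAB dphi.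
set v1 := (fun s => _ - (X1 s, _)); set v2 := (fun s => _ - (X2 s, _)).
have [x11 x12] := W2p_sub_C2 L0 Wu1 XA1 AA1.
have [x21 x22] := W2p_sub_C2 L0 Wu1 XA2 AA2.
have [y11 y12] := W2p_sub_C2 L0 Wu2 YB1 BB1.
have [y21 y22] := W2p_sub_C2 L0 Wu2 YB2 BB2.
have m1 (a b c : R -> R) : W2p p L a -> C1_deriv L b c ->
    measurable_fun (dom L) (wderiv L (fun x => a x - b x)).
  move=> [[_ [g _ ag]] _] bc.
  exact: (measurable_weak (wderivP (weak_derivativeB ag (C1_deriv_weak L0 bc)))).2.
have m2 (a b c e : R -> R) : W2p p L a -> C1_deriv L b c -> C1_deriv L c e ->
    measurable_fun (dom L) (wderiv L (wderiv L (fun x => a x - b x))).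
  move=> Wa bc ce; have [E1 _] := W2p_sub_C2 L0 Wa bc ce.
  have [[_ [g _ ag]] [_ [h _ gh]]] := Wa.
  have D1 := weak_derivativeB ag (C1_deriv_weak L0 bc).
  have D2 := weak_derivativeB gh (C1_deriv_weak L0 ce).
  have D3 : weak_derivative L (wderiv L (fun x => a x - b x)) (fun x => h x - e x).
    apply: weak_derivative_congr D2; first by case: (wderivP D1).
    by apply: ae_imply E1 => x E xL; rewrite E.
  exact: (measurable_weak (wderivP D3)).2.
have m0 (a b c : R -> R) : {within dom L, continuous a} -> C1_deriv L b c ->
    measurable_fun (dom L) (fun x => a x - b x).
  move=> ca [cb _ _]; apply: within_continuous_measurable.
  exact: within_continuousB.
have cu1 := within_continuous_fst cu; have cu2 := within_continuous_snd cu.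
have sub_ae (a b1 b2 : R -> R) (w1 w2 : R -> R) :
    {ae mu, forall x, dom L x -> w1 x = a x - b1 x} ->
    {ae mu, forall x, dom L x -> w2 x = a x - b2 x} ->
    (forall x, dom L x -> `|b1 x - b2 x| <= d) ->
    {ae mu, forall x, dom L x -> `|w2 x - w1 x| <= d}.
  move=> e1 e2 b12; apply: ae_imply2 e1 e2 => x e1 e2 xL.
  by rewrite e1// e2// opprB addrC addrA subrK b12.
have N0 : (Lp_norm p L (enorm \o v2) <= Lp_norm p L (enorm \o v1) + ((d + d) * L `^ p^-1)%:E)%E.
  apply: Lp_norm_enorm_le => //; [exact: m0 cu1 XA2|exact: m0 cu2 YB2|
    exact: m0 cu1 XA1|exact: m0 cu2 YB1| |].
  - apply: (@sub_ae (fst \o u) X1 X2); [exact: aeW|exact: aeW|].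
    by move=> x /dXY[].
  - apply: (@sub_ae (snd \o u) Y1 Y2); [exact: aeW|exact: aeW|].
    by move=> x /dXY[].
have N1 : (Lp_norm p L (enorm \o wderivc L v2) <=
    Lp_norm p L (enorm \o wderivc L v1) + ((d + d) * L `^ p^-1)%:E)%E.
  apply: Lp_norm_enorm_le => //; [exact: m1 Wu1 XA2|exact: m1 Wu2 YB2|
    exact: m1 Wu1 XA1|exact: m1 Wu2 YB1| |].
  - by apply: (sub_ae _ _ _ _ _ x11 x21) => x /dAB[].
  - by apply: (sub_ae _ _ _ _ _ y11 y21) => x /dAB[].
have N2 : (Lp_norm p L (enorm \o wderivc L (wderivc L v2)) <=
    Lp_norm p L (enorm \o wderivc L (wderivc L v1)) + ((d + d) * L `^ p^-1)%:E)%E.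
  apply: Lp_norm_enorm_le => //; [exact: m2 Wu1 XA2 AA2|exact: m2 Wu2 YB2 BB2|
    exact: m2 Wu1 XA1 AA1|exact: m2 Wu2 YB1 BB1| |].
  - apply: (sub_ae _ _ _ _ _ x12 x22) => x /dphi[].
    by rewrite -opprD normrN.
  - by apply: (sub_ae _ _ _ _ _ y12 y22) => x /dphi[].
apply: le_trans (leeD (leeD N0 N1) N2) _.
rewrite /W2p_norm -/v1.
set n0 := Lp_norm _ _ (enorm \o v1); set n1 := Lp_norm _ _ (enorm \o wderivc L v1).
set n2 := Lp_norm _ _ _; set K := L `^ p^-1.
have -> : (6 * d * K)%:E = (((d + d) * K)%:E + ((d + d) * K)%:E + ((d + d) * K)%:E)%E.
  by rewrite -!EFinD; congr EFin; ring.
set q := ((d + d) * K)%:E.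
by rewrite (addeACA n0 q n1 q) (addeACA (n0 + n1)%E (q + q)%E n2 q).
Qed.

Lemma frenet_W2p_arc (phi X Y A B : R -> R) : frenet phi X Y A B ->
  W2p_arc p L (fun s => (X s, Y s)).
Proof.
move=> fr; have [_ AB1 dX dY _] := fr; have [XA AA YB BB] := frenet_C1 fr.
have [x1 _ _] := wderiv_C2 L0 XA AA; have [y1 _ _] := wderiv_C2 L0 YB BB.
split.
- apply: continuous_subspaceT => s.
  have cX : X @ s --> X s by exact: is_derive_continuous dX s.
  have cY : Y @ s --> Y s by exact: is_derive_continuous dY s.
  exact: cvg_pair cX cY.
- by change (W2p p L X); exact: (W2p_C2 p1 L0 XA AA).
- by change (W2p p L Y); exact: (W2p_C2 p1 L0 YB BB).
- apply: ae_imply2 x1 y1 => s x1 y1 sL.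
  rewrite /enorm /wderivc /= [wderiv L _ s]x1// [wderiv L _ s]y1//.
  by rewrite AB1 sqrtr1.
Qed.

(** Almost everywhere the weak second derivative is phi (-B, A), so its product with the normal (-B,
    A) is phi (A^2 + B^2) = phi. *)
Lemma frenet_energy (phi X Y A B : R -> R) (f : R -> \bar R) : frenet phi X Y A B ->
  measurable_fun (`[0, +oo[ : set (measurableTypeR R)) f ->
  (forall x : R, 0 <= x -> (0 <= f x)%E) ->
  energy f L (fun s => (X s, Y s)) = (\int[mu]_(s in dom L) f `|phi s|%R)%E.
Proof.
move=> fr mf f0; have [cphi AB1 dX dY _] := fr; have [XA AA YB BB] := frenet_C1 fr.
have [x1 x2 x2e] := wderiv_C2 L0 XA AA; have [y1 y2 y2e] := wderiv_C2 L0 YB BB.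
set gamma := (fun s => (X s, Y s)).
have [mx1 _] := measurable_weak x2; have [_ mx2] := measurable_weak (wderivP x2).
have [my1 _] := measurable_weak y2; have [_ my2] := measurable_weak (wderivP y2).
have mk : measurable_fun (dom L) (wcurvature L gamma).
  rewrite (_ : wcurvature L gamma = (fun s => wderiv L (wderiv L X) s * - wderiv L Y s +
    wderiv L (wderiv L Y) s * wderiv L X s))//.
  have mNy1 : measurable_fun (dom L) (fun s => - wderiv L Y s) by exact: measurableT_comp.
  exact: measurable_funD (measurable_funM mx2 mNy1) (measurable_funM my2 mx1).
have mfn (k : R -> R) : measurable_fun (dom L) k -> measurable_fun (dom L) (fun s => f `|k s|%R).
  move=> mk'; apply: (@measurable_comp _ _ _ _ _ _ (`[0, +oo[ : set (measurableTypeR R)) f) => //.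
  - by move=> _ [x _ <-] /=; rewrite in_itv/= normr_ge0.
  - exact: measurableT_comp.
apply: ge0_ae_eq_integral => //.
- exact: mfn.
- apply: mfn; apply: within_continuous_measurable; exact: continuous_subspaceT.
- by move=> x _; exact: f0.
- by move=> x _; exact: f0.
have x12 := ae_imply2 (fun x a b => conj a b) x1 x2e.
have y12 := ae_imply2 (fun x a b => conj a b) y1 y2e.
apply: ae_imply2 x12 y12 => s [xs1 xs2] [ys1 ys2] sL.
rewrite /wcurvature /dotp /wderivc /rot90 /=.
rewrite [wderiv L X s]xs1// [wderiv L Y s]ys1//.
rewrite [wderiv L (wderiv L X) s]xs2// [wderiv L (wderiv L Y) s]ys2//.
congr (f `| _ |); rewrite -[RHS]mulr1 -(AB1 s); ring.
Qed.

End frenet_curves.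

(** * The slid curve *)

Lemma periodic_int {R : realType} (U : R) (F : R -> R) (n : int) x :
  (forall x, F (x + U) = F x) -> F (x + n%:~R * U) = F x.
Proof.
move=> FU; have FUn (m : nat) y : F (y + m%:R * U) = F y.
  by elim: m y => [|m IH] y; rewrite ?mul0r ?addr0// -natr1 mulrDl mul1r addrA FU.
case: n => m; first exact: FUn.
by rewrite NegzE mulrNz mulNr -(FUn m.+1) subrK.
Qed.

Lemma frenet_shift {R : realType} (e c1 c2 : R) (phi X Y A B : R -> R) :
  frenet phi X Y A B ->
  frenet (fun s => phi (s + e)) (fun s => X (s + e) + c1) (fun s => Y (s + e) + c2)
    (fun s => A (s + e)) (fun s => B (s + e)).
Proof.
move=> [cphi AB1 dX dY dAB]; split => [s|s|s|s|s].
- apply: (@cvg_comp _ _ _ (shift e) phi _ (nbhs (s + e))); last exact: cphi.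
  by apply: cvgD; [exact: cvg_id|exact: cvg_cst].
- exact: AB1.
- have dXe := is_derive_shift_comp (dX (s + e)).
  have : is_derive s 1 ((fun t => X (t + e)) + cst c1) (A (s + e)).
    by apply: is_derive_eq; rewrite addr0.
  by [].
- have dYe := is_derive_shift_comp (dY (s + e)).
  have : is_derive s 1 ((fun t => Y (t + e)) + cst c2) (B (s + e)).
    by apply: is_derive_eq; rewrite addr0.
  by [].
- have [dA dB] := dAB (s + e).
  by split; [exact: is_derive_shift_comp dA|exact: is_derive_shift_comp dB].
Qed.

(** The derivatives witnessing k are unrelated to the frame, but uniqueness up to the endpoint
    identifies them with it at 0. There phi B = phi A = 0, and A^2 + B^2 = 1 excludes phi(0) <>
    0. *)
Lemma frenet_signed_curvature0 {R : realType} (L : R) (phi X Y A B k : R -> R) :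
  0 < L -> frenet phi X Y A B -> signed_curvature L (fun s => (X s, Y s)) k ->
  k 0 = 0 -> phi 0 = 0.
Proof.
move=> L0 fr [g1 [g2 [C1g C1g1 _ g2E]]] k0.
have [XA AA YB BB] := frenet_C1 L fr; have [_ AB1 _ _ _] := fr.
have zero_in : 0 \in `[0, L] by rewrite in_itv/= lexx ltW.
have g20 : g2 0 = 0 by rewrite g2E ?k0 ?scale0r.
have gA := C1_deriv_unique L0 (C1_deriv_fst C1g) XA (fun _ _ => erefl).
have gB := C1_deriv_unique L0 (C1_deriv_snd C1g) YB (fun _ _ => erefl).
have sub (u v : R -> R) : {in `[0, L], u =1 v} -> {in `]0, L[, u =1 v}.
  by move=> uv x xL; apply: uv; exact: subset_itv_oo_cc xL.
have := C1_deriv_unique L0 (C1_deriv_fst C1g1) AA (sub _ _ gA) zero_in.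
have := C1_deriv_unique L0 (C1_deriv_snd C1g1) BB (sub _ _ gB) zero_in.
rewrite /= g20 /= => A0 B0.
have : phi 0 = phi 0 * (A 0 ^+ 2 + B 0 ^+ 2) by rewrite AB1 mulr1.
by rewrite mulrDr !expr2 !mulrA -A0 mul0r add0r -[phi 0 * B 0]opprK -B0 oppr0 mul0r.
Qed.

Lemma int_multiple_ge {R : realType} (T e : R) (n : int) :
  0 < T -> 0 < e -> e = n%:~R * T -> T <= e.
Proof.
move=> T0 + eE; rewrite eE pmulr_lgt0// ltr0z => n0.
by rewrite -[leLHS]mul1r ler_pM2r// ler1z -gtz0_ge1.
Qed.

(** With d = r / (24 (K + 1)), the term 12 d K is at most r/2; adding 1 to K keeps the denominator
    positive when K = 0. *)
Lemma exists_tolerance {R : realType} (r K : R) : 0 < r -> 0 <= K ->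
  exists d : R, [/\ 0 < d, 0 <= 2 * d & r / 2 + 6 * (2 * d) * K <= r].
Proof.
move=> r0 K0; have K1 : 0 < K + 1 by rewrite ltr_wpDl.
have d0 : 0 < r / (24 * (K + 1)) by rewrite divr_gt0// mulr_gt0.
exists (r / (24 * (K + 1))); split; [by []|lra|].
have : r / (24 * (K + 1)) * (K + 1) = r / 24.
  by field; rewrite lt0r_neq0.
move: d0; move: (r / (24 * (K + 1))) => d d0 dE.
have : d * K <= d * (K + 1) by rewrite ler_wpM2l ?(ltW d0)// lerDl.
lra.
Qed.

Unset Implicit Arguments.

Theorem theorem2p7 (R : realType) (p L : R) (P0 P1 : R * R) (f : R -> \bar R)
    (hp : 1 < p) (hL : 0 < L) (hP : enorm (P0 - P1) < L)
    (hf_meas : measurable_fun (`[0, +oo[ : set (measurableTypeR R)) f)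
    (hf_ge0 : forall x : R, 0 <= x -> (0 <= f x)%E)
    (hreg : forall gamma : R -> R * R,
       local_minimizer p L (A_pin p L P0 P1) (energy f L) gamma ->
       C2 L gamma /\
       exists k : R -> R, [/\ signed_curvature L gamma k, k 0 = 0 & k L = 0])
    (gamma : R -> R * R)
    (hgamma : A_pin p L P0 P1 gamma)
    (hfold : half_fold 2 L gamma) :
  ~ local_minimizer p L (A_pin p L P0 P1) (energy f L) gamma.
Proof.
have p1 := ltW hp.
case: hfold => _ [k [T [[sc _ T0 [s0 [Phi [cPhi oddPhi antiPhi zeroPhi kE]]]] k0 TE]]].
case: hgamma => _ g0 gL [_ [r r0 gmin]].
have LE : L = T + T by rewrite TE -splitr.
have dom0 : dom L 0 by rewrite /dom/= in_itv/= lexx ltW.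
have domL : dom L L by rewrite /dom/= in_itv/= lexx ltW.
have PhiL x : Phi (x + L) = Phi x by rewrite LE addrA !antiPhi opprK.
(* This is k(0) = Phi(-s0) = 0 read through the zero set of Phi. *)
have [n s0E] : exists n : int, - s0 = n%:~R * T.
  by apply/zeroPhi; rewrite -sub0r -kE.
pose phi s := Phi (s - s0).
have cphi : continuous phi.
  move=> s; apply: (@cvg_comp _ _ _ (shift (- s0)) Phi _ (nbhs (s - s0))); last exact: cPhi.
  by apply: cvgD; [exact: cvg_id|exact: cvg_cst].
have phiL s : phi (s + L) = phi s by rewrite /phi addrAC PhiL.
(* The arguments -s - s0 and -(s - s0) differ by -2 s0 = 2nT = nL, a multiple of the period. *)
have phiN s : phi (- s) = - phi s.
  rewrite /phi -oddPhi -(@periodic_int _ L Phi n (- (s - s0)))//; congr Phi.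
  by rewrite LE mulrDr -s0E; ring.
have [X [Y [A [B [fr AL BL gE]]]]] := frenet_extension hL cphi phiN phiL kE sc.
pose G s := (X s, Y s).
have gG : {in dom L, gamma =1 G} by move=> s; rewrite inE => /gE.
have [_ AB1 dX dY dAB] := fr.
have [d [d0 d20 le_r]] := exists_tolerance r0 (powR_ge0 L p^-1).
have cX := is_derive_continuous dX; have cY := is_derive_continuous dY.
have cA := is_derive_continuous (fun s => (dAB s).1).
have cB := is_derive_continuous (fun s => (dAB s).2).
have cphiA : continuous (fun s => phi s * A s) by move=> s; apply: cvgM; [exact: cphi|exact: cA].
have cphiB : continuous (fun s => phi s * B s) by move=> s; apply: cvgM; [exact: cphi|exact: cB].
(* The bounds 0 < e < T keep e out of TZ, so that the curvature at e is nonzero; the remaining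
   conditions make the slide uniformly small. *)
have [e [e0 eT eX eY [eA eB ephiA ephiB]]] : exists e, [/\ 0 < e, e < T,
    forall s, s \in `[0, L] -> `|X (s + e) - X s| <= d,
    forall s, s \in `[0, L] -> `|Y (s + e) - Y s| <= d & [/\
    forall s, s \in `[0, L] -> `|A (s + e) - A s| <= d,
    forall s, s \in `[0, L] -> `|B (s + e) - B s| <= d,
    forall s, s \in `[0, L] -> `|phi (s + e) * A (s + e) - phi s * A s| <= d &
    forall s, s \in `[0, L] -> `|phi (s + e) * B (s + e) - phi s * B s| <= d]].
  near (0 : R)^'+ => e; exists e; split; [| |near: e..|split; near: e].
  - by near: e; exact: nbhs_right_gt.
  - by near: e; exact: nbhs_right_lt.
  - exact/cvg_within/(uniform_shift L cX d0).
  - exact/cvg_within/(uniform_shift L cY d0).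
  - exact/cvg_within/(uniform_shift L cA d0).
  - exact/cvg_within/(uniform_shift L cB d0).
  - exact/cvg_within/(uniform_shift L cphiA d0).
  - exact/cvg_within/(uniform_shift L cphiB d0).
(* The translation by P0 - (X e, Y e) brings the starting point of the slid curve back to P0. *)
have fre := frenet_shift e (P0.1 - X e) (P0.2 - Y e) fr.
set phie := (fun s => phi (s + e)) in fre.
set Xe := (fun s => X (s + e) + _) in fre; set Ye := (fun s => Y (s + e) + _) in fre.
pose eta s := (Xe s, Ye s).
have P0E : P0 = (X 0, Y 0) by rewrite -g0 gE.
have P1E : P1 = (X L, Y L) by rewrite -gL gE.
(* A function with L-periodic derivative has the same increment over every window of length L; hence
   the slid curve ends at P1. *)
have shiftL (u v : R -> R) : (forall s : R, is_derive s 1 u (v s)) ->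
    (forall s, v (s + L) = v s) -> u (e + L) - u e = u L - u 0.
  move=> du vL; have duL (s : R) : is_derive s 1 ((fun t => u (t + L)) - u) 0.
    have := is_derive_shift_comp (du (s + L)) => duL; have dus := du s.
    by apply: is_derive_eq; rewrite vL subrr.
  by have := is_derive_0_is_cst e 0 duL; rewrite /= -[LHS]/(u (e + L) - u e) -[RHS]/(u (0 + L) - u 0) add0r.
have etaA : A_pin p L P0 P1 eta.
  split; first exact: frenet_W2p_arc fre.
  - by rewrite /eta /Xe /Ye add0r !subrKC -surjective_pairing.
  - rewrite P1E /eta /Xe /Ye P0E /= (addrC L e); congr (_, _).
      by rewrite addrCA (shiftL _ _ dX AL) subrKC.
    by rewrite addrCA (shiftL _ _ dY BL) subrKC.
have Feta : energy f L eta = energy f L gamma.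
  rewrite (energy_congr f gG) (frenet_energy hL fre)// (frenet_energy hL fr)//.
  apply: (@ge0_integral_periodic_shift _ L e (fun s => f `|phi s|%R)).
  - by rewrite ltW//= (le_trans (ltW eT))// LE lerDl ltW.
  - apply: (@measurable_comp _ _ _ _ _ _ (`[0, +oo[ : set (measurableTypeR R)) f) => //.
    + by move=> _ [x _ <-] /=; rewrite in_itv/= normr_ge0.
    + by apply: measurableT_comp => //; exact: continuous_measurable_fun.
  - by move=> x; exact: hf_ge0.
  - by move=> x; rewrite phiL.
have : local_minimizer p L (A_pin p L P0 P1) (energy f L) eta.
  split; first exact: etaA.
  (* A curve within r/2 of [eta] is within r of [gamma], hence has at least the energy of [gamma],
     which is that of [eta]. *)
  exists (r / 2); first by rewrite divr_gt0.
  move=> x xA xr; rewrite Feta; apply: (gmin x xA).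
  have [[cx Wx1 Wx2 _] _ _] := xA.
  rewrite (@W2p_norm_congr _ _ _ _ (fun s => (x s - (X s, Y s))%R)); last first.
    by move=> s sL; rewrite gG.
  (* One d bounds the slide at s; the other bounds the translation, which undoes the slide at 0. *)
  have sh (u : R -> R) (c s : R) : c = u 0 ->
      (forall t, t \in `[0, L] -> `|u (t + e) - u t| <= d) -> s \in `[0, L] ->
      `|u (s + e) + (c - u e) - u s| <= 2 * d.
    move=> -> du sL; have := du s sL; have := du 0 dom0; rewrite add0r !ler_norml; lra.
  have dXY s : dom L s -> `|Xe s - X s| <= 2 * d /\ `|Ye s - Y s| <= 2 * d.
    move=> sL; split; [exact: (sh X _ s (congr1 fst P0E) eX sL)|].
    exact: (sh Y _ s (congr1 snd P0E) eY sL).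
  have dAB' s : dom L s -> `|A (s + e) - A s| <= 2 * d /\ `|B (s + e) - B s| <= 2 * d.
    move=> sL; have := eA s sL; have := eB s sL; split; lra.
  have dphi s : dom L s -> `|phie s * B (s + e) - phi s * B s| <= 2 * d /\
      `|phie s * A (s + e) - phi s * A s| <= 2 * d.
    move=> sL; have := ephiA s sL; have := ephiB s sL; rewrite /phie; split; lra.
  apply: le_lt_trans (W2p_norm_le p1 hL cx Wx1 Wx2 fre fr d20 dXY dAB' dphi) _.
  apply: (@lt_le_trans _ _ ((r / 2)%:E + (6 * (2 * d) * L `^ p^-1)%:E)%E).
    exact: lte_leD xr (lexx _).
  by rewrite -EFinD lee_fin le_r.
move=> /hreg[_ [k' [sc' k'0 _]]].
have := frenet_signed_curvature0 hL fre sc' k'0.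
(* Zero curvature at e would give e = (m - n) T, hence e >= T since e > 0. *)
rewrite /phie add0r /phi => /zeroPhi[m].
rewrite s0E => /(canRL (addrK _)); rewrite -mulrBl -intrB.
by move=> /(int_multiple_ge T0 e0); rewrite leNgt eT.
Unshelve. all: by end_near. Qed.
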